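(* Let the couplings $\mathcal{J}=(J_{xy})$ on the nearest-neighbour edges of the square lattice $\mathbb{Z}^2$ be i.i.d. with a symmetric continuous distribution whose support is all of $\mathbb{R}$. Let $\mu$ be a translation-invariant joint distribution of couplings $\mathcal{J}$ (whose marginal law on couplings is this i.i.d. law with symmetric continuous distribution supported on all of $\mathbb{R}$) and ground state pairs (GSPs) for $\mathcal{J}$. Then $\mu$-almost surely the dual unsatisfied edges of the GSP do not percolate, i.e. all connected components of the subgraph of the dual lattice formed by the unsatisfied dual edges are finite.
   Context: The Edwards-Anderson Ising spin glass on a graph $G$ has (formal) Hamiltonian $\mathcal{H}_{\mathcal{J}}(\sigma)=-\sum_{\langle x,y\rangle}J_{xy}\sigma_x\sigma_y$, the sum being over edges of $G$, where $\sigma\in\{-1,1\}^{V(G)}$ is a spin configuration. A ground state for $\mathcal{J}$ is a configuration whose energy cannot be lowered by flipping any finite set of spins: for every finite set $C$ of vertices, $-\sum_{\langle x,y\rangle\in\partial C}J_{xy}\sigma_x\sigma_y\le 0$, where $\partial C$ is the set of edges connecting $C$ to its complement. If $\sigma$ is a ground state so is $-\sigma$; the pair $\{\sigma,-\sigma\}$ is called a ground state pair (GSP). An edge $\{x,y\}$ is unsatisfied in $\sigma$ if $J_{xy}\sigma_x\sigma_y<0$ (this depends only on the pair $\{\sigma,-\sigma\}$); in this case the edge of the dual lattice crossing it is also called unsatisfied. Translation-invariant means invariant under the simultaneous action of $\mathbb{Z}^2$-translations on couplings and GSPs. *)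

(* Defs.v *)
From HB Require Import structures.
From mathcomp Require Import all_boot all_order all_algebra finmap.
From mathcomp Require Import all_classical all_reals all_analysis.
Set Implicit Arguments.
Unset Strict Implicit.
Unset Printing Implicit Defensive.
Import Order.TTheory GRing.Theory Num.Theory.
Import numFieldNormedType.Exports.
Local Open Scope classical_set_scope.
Local Open Scope ring_scope.

Definition product_generators d (I : Type) (T : measurableType d) :
    set (set (I -> T)) :=
  \bigcup_(i in [set: I])
    preimage_set_system setT (fun f : I -> T => f i) measurable.

(* The functions I -> T with the product sigma-algebra. *)
Definition product_space d (I : Type) (T : measurableType d) :=
  g_sigma_algebraType (@product_generators d I T).

Definition mutually_independent d d' (T : measurableType d)
    (S : measurableType d') (R : realType) (P : probability T R)
    (I : choiceType) (X : I -> T -> S) :=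
  forall (F : {fset I}) (A : I -> set S), (forall i, measurable (A i)) ->
    P (\bigcap_(i in [set` F]) X i @^-1` A i) =
    (\prod_(i <- F) P (X i @^-1` A i))%E.

Definition iid_with_law d d' (T : measurableType d) (S : measurableType d')
    (R : realType) (P : probability T R) (nu : probability S R)
    (I : choiceType) (X : I -> T -> S) :=
  (forall i A, measurable A -> P (X i @^-1` A) = nu A) /\
  mutually_independent P X.

Section real_laws.
Variables (R : realType) (nu : probability (measurableTypeR R) R).

Definition symmetric_law :=
  forall A : set (measurableTypeR R), measurable A ->
    nu ((fun x : R => - x) @^-1` A) = nu A.

Definition continuous_law := forall x : R, nu [set x] = 0%E.

Definition law_support : set R :=
  [set x | forall U : set R, open U -> U x -> (0 < nu U)%E].

End real_laws.

Definition vertex := (int * int)%type.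

Definition unit_vector (vertical : bool) : vertex :=
  if vertical then (0, 1) else (1, 0).

(* (x, d) is the unoriented edge {x, x + unit_vector d}; every nearest-neighbour
   edge of Z^2 has exactly one such code. *)
Definition edge := (vertex * bool)%type.
Definition edge_fst (e : edge) : vertex := e.1.
Definition edge_snd (e : edge) : vertex := e.1 + unit_vector e.2.

(* A dual vertex is coded by the lower-left corner x of the unit face it is the
   centre of, so it stands for x + (1/2, 1/2). The dual edge crossing e joins
   the two faces bordering e: those with lower-left corner x and x - (0, 1) when
   e = {x, x + (1, 0)}, and x and x - (1, 0) when e = {x, x + (0, 1)}. *)
Definition dual_vertex := (int * int)%type.
Definition dual_fst (e : edge) : dual_vertex := e.1.
Definition dual_snd (e : edge) : dual_vertex := e.1 - unit_vector (~~ e.2).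

Definition couplings (R : realType) := product_space edge (measurableTypeR R).

(* The boolean b codes the spin (-1) ^+ b. *)
Definition spins := product_space vertex bool.

Definition spin (R : realType) (s : spins) (x : vertex) : R := (-1) ^+ s x.

Definition global_flip (s : spins) : spins := fun x => ~~ s x.

(* An unordered pair {s, - s}. *)
Record flip_pair := FlipPair {
  pair_set : set spins ;
  pair_setP : exists s, pair_set = [set s; global_flip s] }.

Definition pair_of (s : spins) : flip_pair :=
  FlipPair (ex_intro _ s (erefl [set s; global_flip s])).

HB.instance Definition _ := gen_eqMixin flip_pair.
HB.instance Definition _ := gen_choiceMixin flip_pair.
HB.instance Definition _ := isPointed.Build flip_pair (pair_of point).

(* Flip pairs carry the quotient sigma-algebra: B is measurable iff its preimage
   under pair_of is. *)
Definition spin_pairs :=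
  g_sigma_algebraType (image_set_system setT pair_of measurable).

Lemma measurable_spin_pairsE (B : set spin_pairs) :
  measurable B <-> measurable (pair_of @^-1` B).
Proof.
rewrite /measurable /= sigma_algebra_id; last first.
  exact: sigma_algebra_image (sigma_algebra_measurable _).
by rewrite /image_set_system /= setTI.
Qed.

Section spin_glass.
Variable R : realType.
Implicit Types (J : couplings R) (s : spins) (P : spin_pairs).

Definition bond J s (e : edge) : R :=
  J e * spin R s (edge_fst e) * spin R s (edge_snd e).

Definition edge_boundary (C : set vertex) : set edge :=
  [set e | C (edge_fst e) /\ ~ C (edge_snd e) \/
           ~ C (edge_fst e) /\ C (edge_snd e)].

(* A sum over an infinite set is 0 by convention; see finite_edge_boundary. *)
Definition ground_state J s :=
  forall C : set vertex, finite_set C ->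
    - \sum_(e \in edge_boundary C) bond J s e <= 0.

Definition ground_state_pair J P := forall s, pair_set P s -> ground_state J s.

Definition unsatisfied J P (e : edge) :=
  exists2 s, pair_set P s & bond J s e < 0.

Definition dual_unsatisfied_adj J P (f g : dual_vertex) :=
  exists2 e, unsatisfied J P e &
    (dual_fst e = f /\ dual_snd e = g) \/ (dual_fst e = g /\ dual_snd e = f).

Definition dual_component J P (f : dual_vertex) : set dual_vertex :=
  [set g | exists2 p : seq dual_vertex,
     path (fun x y => `[< dual_unsatisfied_adj J P x y >]) f p & last f p = g].

Definition percolates J P :=
  exists f : dual_vertex, infinite_set (dual_component J P f).

End spin_glass.

Lemma finite_edge_boundary (C : set vertex) :
  finite_set C -> finite_set (edge_boundary C).
Proof.
move=> finC.
have finCB : finite_set (C `*` [set: bool]) by exact: finite_setX.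
apply: (@sub_finite_set _ _ ((C `*` [set: bool]) `|`
  (fun z => (z.1 - unit_vector z.2, z.2)) @` (C `*` [set: bool]))); last first.
  by rewrite finite_setU; split => //; exact: finite_image.
move=> [x d] [[/= Cx _]|[/= _ Cy]]; [by left | right].
by exists (x + unit_vector d, d) => //=; rewrite addrK.
Qed.

Definition translate_couplings (R : realType) (a : vertex) (J : couplings R) :
  couplings R := fun e => J (e.1 + a, e.2).

Definition translate_spins (a : vertex) (s : spins) : spins :=
  fun x => s (x + a).

Lemma translate_pair_subproof (a : vertex) (P : spin_pairs) :
  exists s, translate_spins a @` pair_set P = [set s; global_flip s].
Proof.
have [s Ps] := pair_setP P; exists (translate_spins a s).
by rewrite Ps image_setU !image_set1.
Qed.

Definition translate_pair (a : vertex) (P : spin_pairs) : spin_pairs :=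
  FlipPair (translate_pair_subproof a P).

Definition translation_invariant (R : realType)
    (mu : probability (couplings R * spin_pairs)%type R) :=
  forall (a : vertex) (A : set (couplings R * spin_pairs)), measurable A ->
    mu ((fun w => (translate_couplings a w.1, translate_pair a w.2)) @^-1` A)
    = mu A.

(* Main.v *)
Require Import Defs.
From HB Require Import structures.
From mathcomp Require Import all_boot all_order all_algebra finmap.
From mathcomp Require Import all_classical all_reals all_analysis.
From mathcomp Require Import measurable_realfun zify ring lra.
Local Open Scope classical_set_scope.

(* Let E_L be the event that some self-avoiding dual walk of length L from a
   fixed face crosses only unsatisfied edges; by translation invariance P(E_L)
   does not depend on the face, and percolation forces some face to satisfy all
   the E_L, so it suffices that P(E_L) -> 0. Partition an n x n box, n = N(2L+1),
   into N^2 boxes of radius L; on average P(E_L) N^2 of the centres start such a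
   walk.
   Flipping the sign of the couplings on any subset of the unsatisfied edges of
   these walks preserves the law of the couplings and keeps the configuration a
   ground state. Conversely, for generic couplings, the flipped couplings
   determine the original ones, the walks and the flipped subset, up to
   - the spins on the boundary of the large box (a ground state with given
     boundary values is unique), that is 2^O(n) possibilities;
   - the end point of each walk (an unsatisfied walk is the unique geodesic for
     the weights |J| between its ends, because the symmetric difference of two
     walks with the same ends is the boundary of a finite set), that is
     O(L^4)^(N^2) possibilities.
   If t walks occur then there are 2^(tL) subsets to flip, so this event has
   probability at most 2^O(NL) O(L^4)^(N^2) / 2^(tL). With t a fixed fraction of
   N^2, L large and then N large, this tends to 0, hence so does P(E_L). *)

Set Implicit Arguments.
Unset Strict Implicit.
Unset Printing Implicit Defensive.
Import Order.TTheory GRing.Theory Num.Theory.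
Import numFieldNormedType.Exports.
Local Open Scope ring_scope.

(** * Dual walks *)

Definition dir := (bool * bool)%type.
Definition move (f : dual_vertex) (d : dir) : dual_vertex :=
  if d.2 then f + unit_vector d.1 else f - unit_vector d.1.
(** An edge is based at the upper or right one of the two faces it separates, so only a positive
    step shifts the base; a step along one axis crosses an edge along the other. *)
Definition crossed (f : dual_vertex) (d : dir) : edge :=
  (if d.2 then f + unit_vector d.1 else f, ~~ d.1).

Definition visited (f : dual_vertex) (ds : seq dir) := f :: scanl move f ds.
Definition walk_end (f : dual_vertex) (ds : seq dir) := foldl move f ds.
Fixpoint crossings (f : dual_vertex) (ds : seq dir) : seq edge :=
  if ds is d :: ds' then crossed f d :: crossings (move f d) ds' else [::].

Lemma crossed_ends f d :
  (dual_fst (crossed f d) = move f d /\ dual_snd (crossed f d) = f) \/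
  (dual_fst (crossed f d) = f /\ dual_snd (crossed f d) = move f d).
Proof.
rewrite /crossed /dual_fst /dual_snd /move negbK.
by case: d => v [] /=; [left; rewrite addrK | right].
Qed.

Lemma dual_edge_crossed e f g :
  (dual_fst e = f /\ dual_snd e = g) \/ (dual_fst e = g /\ dual_snd e = f) ->
  exists2 d, move f d = g & crossed f d = e.
Proof.
case: e => y b; rewrite /dual_fst /dual_snd /= => -[] [<- <-].
  by exists (~~ b, false) => //; rewrite /crossed /= negbK.
by exists (~~ b, true); rewrite /move /crossed /= subrK ?negbK.
Qed.

Lemma size_crossings f ds : size (crossings f ds) = size ds.
Proof. by elim: ds f => //= d ds IH f; rewrite IH. Qed.

Lemma crossings_visited f ds e : e \in crossings f ds ->
  (dual_fst e \in visited f ds) && (dual_snd e \in visited f ds).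
Proof.
elim: ds f => //= d ds IH f; rewrite inE => /orP[/eqP->|/IH /andP[h1 h2]].
  by have [[-> ->]|[-> ->]] := crossed_ends f d; rewrite !inE !eqxx ?orbT.
by rewrite /visited /= in h1 h2 *; rewrite inE h1 orbT inE h2 orbT.
Qed.

Lemma crossings_uniq f ds : uniq (visited f ds) -> uniq (crossings f ds).
Proof.
elim: ds f => //= d ds IH f /andP[fN /[dup] u /IH ->]; rewrite andbT.
apply/negP => /crossings_visited /andP[h1 h2]; move/negP: fN; apply.
by have [[_ e]|[e _]] := crossed_ends f d; rewrite e in h1 h2.
Qed.

Definition close_to (L : nat) (f h : dual_vertex) :=
  (`|(h.1 - f.1)%R| <= L)%N && (`|(h.2 - f.2)%R| <= L)%N.

Lemma visited_close f ds h : h \in visited f ds -> close_to (size ds) f h.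
Proof.
elim: ds f => /= [f|d ds IH f].
  by rewrite inE => /eqP->; rewrite /close_to !subrr.
rewrite inE => /orP[/eqP->|/IH]; first by rewrite /close_to !subrr.
case: f d => f1 f2 [[] []]; rewrite /close_to /move /=; lia.
Qed.

(* The parity of the crossings of the horizontal ray going left from x along a
   closed dual walk tells on which side of the walk x is. *)
Definition left_of (x : vertex) (e : edge) :=
  [&& ~~ e.2, e.1.2 == x.2 & e.1.1 < x.1].

Definition ray_parity x f ds := odd (count (left_of x) (crossings f ds)).

Lemma ray_parity_horizontal x f ds :
  ray_parity (x + (1, 0)) f ds =
  ray_parity x f ds (+) odd (count_mem (x, false) (crossings f ds)).
Proof.
have step e : left_of (x + (1, 0)) e = left_of x e (+) (e == (x, false)).
  case: x e => x1 x2 [[y1 y2] []]; rewrite /left_of /= !xpair_eqE; lia.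
rewrite /ray_parity; set y := x + _ in step *; clearbody y.
elim: ds f => //= d ds IH f; rewrite !oddD IH step.
by rewrite !oddb; do 2![case: odd]; case: left_of; case: eqP.
Qed.

(** The indicator [g] marks the faces of the half-strip between the rays of [x] and [x + (0, 1)],
    closed on the right by the edge [(x, true)]. A step changes it exactly when it crosses this
    boundary, and the changes telescope along the walk. *)
Lemma ray_parity_vertical x f ds :
  ray_parity (x + (0, 1)) f ds (+) ray_parity x f ds
    (+) odd (count_mem (x, true) (crossings f ds)) =
  ((f.2 == x.2) && (f.1 < x.1)) (+)
  (((walk_end f ds).2 == x.2) && ((walk_end f ds).1 < x.1)).
Proof.
pose g (h : dual_vertex) := (h.2 == x.2) && (h.1 < x.1).
rewrite -!/(g _) /ray_parity.
have step h d : left_of (x + (0, 1)) (crossed h d) (+) left_of x (crossed h d)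
    (+) (crossed h d == (x, true)) = g h (+) g (move h d).
  rewrite {}/g; case: x h d => x1 x2 [f1 f2] [v []];
  rewrite /left_of /crossed /move /= xpair_eqE; case: v => /=.
  - by rewrite !addr0 (inj_eq (addIr 1)) /= andbF addbF.
  - rewrite xpair_eqE !addr0 eqxx andbT andbC.
    case: (f2 == x2) => //=; lia.
  - by rewrite !addr0 ?subr0 subr_eq /= andbF addbF addbC.
  - rewrite xpair_eqE ?subr0 ?addr0 eqxx andbT andbC.
    case: (f2 == x2) => //=; lia.
set y := x + _ in step *; clearbody y g.
elim: ds f => /= [f|d ds IH f]; first by rewrite addbb.
rewrite !oddD !oddb; have := IH (move f d); have := step f d.
do 2![case: left_of]; case: (_ == _); do 3![case: odd];
by do 2![case: (g _)]; case: (g _).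
Qed.

(** With the whole walk to its left, the ray acts as a full horizontal line, crossed an odd number
    of times exactly when the ends lie on opposite sides. *)
Lemma ray_parity_right x f ds : (forall h, h \in visited f ds -> h.1 < x.1) ->
  ray_parity x f ds = (f.2 < x.2) (+) ((walk_end f ds).2 < x.2).
Proof.
rewrite /ray_parity; elim: ds f => /= [f _|d ds IH f hv]; first by rewrite addbb.
rewrite !oddD oddb IH; last by move=> h hin; apply: hv; rewrite inE hin orbT.
suff -> : left_of x (crossed f d) = (f.2 < x.2) (+) ((move f d).2 < x.2).
  by do 3![case: (_ < _)].
have := hv (move f d); have := hv f.
rewrite !inE !eqxx orbT => /(_ erefl) h1 /(_ erefl).
case: x f d {IH hv} h1 => x1 x2 [f1 f2] [[] []];
  rewrite /left_of /crossed /move /=; lia.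
Qed.

(** For walks with a common end, this is the inside modulo 2 of the closed curve that they form. *)
Definition enclosed f ds1 ds2 : set vertex :=
  [set x | ray_parity x f ds1 (+) ray_parity x f ds2].

Lemma odd_count_mem (T : eqType) (s : seq T) x : uniq s ->
  odd (count_mem x s) = (x \in s).
Proof. by move=> u; rewrite count_uniq_mem //; case: (_ \in _). Qed.

Lemma edge_boundary_addb (c : vertex -> bool) e :
  edge_boundary [set x | c x] e <-> c (edge_fst e) (+) c (edge_snd e).
Proof.
rewrite /edge_boundary /=; case: (c _); case: (c _) => /=; intuition done.
Qed.

(** Along a horizontal edge each parity changes by the number of crossings of that edge. Along a
    vertical edge there are also terms from the ends of the walks, which cancel because the ends
    agree. Self-avoidance turns parity into membership. *)
Lemma edge_boundary_enclosed f ds1 ds2 e :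
  uniq (visited f ds1) -> uniq (visited f ds2) ->
  walk_end f ds1 = walk_end f ds2 ->
  edge_boundary (enclosed f ds1 ds2) e <->
  (e \in crossings f ds1) (+) (e \in crossings f ds2).
Proof.
move=> u1 u2 eend; rewrite edge_boundary_addb /edge_fst /edge_snd.
rewrite -!odd_count_mem ?crossings_uniq //.
case: e => x [] /=.
  have := ray_parity_vertical x f ds1; have := ray_parity_vertical x f ds2.
  rewrite -eend; set g := _ (+) (_ && _).
  do 4![case: ray_parity]; do 2![case: odd]; case: g => //=.
rewrite !ray_parity_horizontal.
by do 2![case: ray_parity]; do 2![case: odd].
Qed.

(** Some walk crosses an edge to the left of [x] in its row, which bounds the height of [x] and
    bounds it from the left. To the right of both walks the two parities agree by
    [ray_parity_right]. *)
Lemma enclosed_close L f ds1 ds2 x : (size ds1 <= L)%N -> (size ds2 <= L)%N ->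
  walk_end f ds1 = walk_end f ds2 -> enclosed f ds1 ds2 x -> close_to L f x.
Proof.
move=> s1 s2 eend encl.
have step ds h : (size ds <= L)%N -> h \in visited f ds -> close_to L f h.
  by move=> sds /visited_close; rewrite /close_to; lia.
have [e [e2 ex2 ex1 /andP[]]] : exists e, [/\ ~~ e.2, e.1.2 = x.2, e.1.1 < x.1 &
    close_to L f (dual_fst e) && close_to L f (dual_snd e)].
  have aux ds : (size ds <= L)%N -> ray_parity x f ds -> exists e,
    [/\ ~~ e.2, e.1.2 = x.2, e.1.1 < x.1 &
      close_to L f (dual_fst e) && close_to L f (dual_snd e)].
    move=> sds odd_; have /hasP[e ein /and3P[? /eqP ? ?]] :
        has (left_of x) (crossings f ds).
      by rewrite has_count; move: odd_; rewrite /ray_parity; case: (count _ _).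
    exists e; split => //.
    by have /andP[i1 i2] := crossings_visited ein; rewrite !(step ds).
  move: encl; rewrite /enclosed /=.
  by case r1: ray_parity; case r2: ray_parity => // _; [apply: (aux ds1)|apply: (aux ds2)].
have : (x.1 <= f.1 + L%:Z).
  rewrite leNgt; apply/negP => fx; move: encl; rewrite /enclosed /=.
  have hv ds : (size ds <= L)%N -> forall h, h \in visited f ds -> h.1 < x.1.
    move=> sds h /(step _ _ sds) /andP[+ _]; move: fx.
    by move: (x.1) (f.1) (h.1) => a b c; lia.
  by rewrite (ray_parity_right (hv _ s1)) (ray_parity_right (hv _ s2)) eend addbb.
move: e2 ex2 ex1; case: e f {step s1 s2 eend encl} x => [[e1 e2] []] [f1 f2] [x1 x2] //=.
rewrite /close_to /dual_fst /dual_snd /=; lia.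
Qed.

Lemma crossed_inj f d d' : crossed f d = crossed f d' -> d = d'.
Proof.
case: f => f1 f2; case: d => [[] []]; case: d' => [[] []] //=; rewrite /crossed /=;
  by case; lia.
Qed.

(** The first edge crossed by one walk is also the first for the other, since a later crossing would
    bring that walk back to [f]. *)
Lemma crossings_inj f ds1 ds2 :
  uniq (visited f ds1) -> uniq (visited f ds2) ->
  crossings f ds1 =i crossings f ds2 -> ds1 = ds2.
Proof.
elim: ds1 ds2 f => [|d1 ds1 IH] [|d2 ds2] f //.
- by move=> _ _ /(_ (crossed f d2)); rewrite /= !inE eqxx.
- by move=> _ _ /(_ (crossed f d1)); rewrite /= !inE eqxx.
move=> uv1 uv2 eqc.
have U1 := crossings_uniq uv1; have U2 := crossings_uniq uv2.
move: uv1 uv2 => /= /andP[f1 u1] /andP[f2 u2].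
have dE : d1 = d2.
  have := eqc (crossed f d1); rewrite !inE eqxx /= => /esym/orP[/eqP/crossed_inj//|].
  move=> /crossings_visited /andP[h1 h2].
  case/negP: f2.
  by have [[_ e]|[e _]] := crossed_ends f d1; rewrite e in h1 h2.
subst d2; congr cons; apply: (IH _ (move f d1)) => // e.
have := eqc e; rewrite !inE; case: eqP => //= -> _.
by move: U1 U2 => /= /andP[/negPf-> _] /andP[/negPf-> _].
Qed.

Lemma walk_end_count f ds :
  walk_end f ds = f + unit_vector false *+ count_mem (false, true) ds
    - unit_vector false *+ count_mem (false, false) ds
    + unit_vector true *+ count_mem (true, true) ds
    - unit_vector true *+ count_mem (true, false) ds.
Proof.
elim: ds f => /= [f|d ds IH f]; first by rewrite !mulr0n subr0 addr0 subr0 addr0.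
rewrite IH /move !mulrnDr; case: d => [[] []] /=; rewrite !mulr0n !mulr1n.
all: ring.
Qed.

(** * Finite-volume ground states *)

Section ground_states.
Variable R : realType.
Implicit Types (J : couplings R) (s : spins).

Definition flip_couplings (F : pred edge) J : couplings R :=
  fun e => if F e then - J e else J e.

Definition square (n : nat) : set vertex :=
  [set x | (0 <= x.1 < n%:Z) && (0 <= x.2 < n%:Z)].
Definition padded (n : nat) : set vertex :=
  [set x | (-1 <= x.1 <= n%:Z) && (-1 <= x.2 <= n%:Z)].

(** Letting [C] range over the countable type [{fset vertex}] makes this condition measurable in
    [J]. *)
Definition local_ground n J s := forall C : {fset vertex},
  [set` C] `<=` square n -> 0 <= \sum_(e \in edge_boundary [set` C]) bond J s e.

(* The signs are given by a finite set F so that this is a countable condition. *)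
Definition generic J := forall D F : {fset edge}, D != fset0 ->
  \sum_(e <- D) (-1) ^+ (e \in F) * J e != 0.

Lemma generic_sum J (D : {fset edge}) (eps : edge -> bool) : generic J ->
  \sum_(e <- D) (-1) ^+ eps e * J e = 0 -> D = fset0.
Proof.
move=> gen; rewrite (eq_big_seq (fun e =>
    (-1) ^+ (e \in [fset x in D | eps x]%fset) * J e)); last first.
  by move=> e eD; rewrite !inE /= eD.
by apply: contra_eq; exact: gen.
Qed.

Lemma bond_sign J s e : bond J s e = (-1) ^+ (s (edge_fst e) (+) s (edge_snd e)) * J e.
Proof. by rewrite /bond /spin signr_addb [RHS]mulrC mulrA. Qed.

Lemma normr_bond J s e : `|bond J s e| = `|J e|.
Proof. by rewrite bond_sign normrM normr_sign mul1r. Qed.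

Lemma normr_sign_mul (x : R) : `|x| = (-1) ^+ (x < 0)%R * x.
Proof.
have [h|h] := ltP x 0; first by rewrite expr1 mulN1r ltr0_norm.
by rewrite expr0 mul1r ger0_norm.
Qed.

(** A nonempty set without boundary edges would contain the whole ray to the right of [x]. *)
Lemma edge_boundary_neq0 (C : set vertex) x : finite_set C -> C x ->
  exists e, edge_boundary C e.
Proof.
move=> finC Cx; apply: contrapT => nobd.
have step y : C y -> C (y + (1, 0)).
  move=> Cy; apply: contrapT => nCy; apply: nobd.
  by exists (y, false); left.
have iter k : C (x + (k%:Z, 0)).
  elim: k => [|k /step]; first by rewrite addr0.
  suff -> : x + (k.+1%:Z, 0) = x + (k%:Z, 0) + (1, 0) by [].
  by rewrite -addrA; congr (_ + _); rewrite -addn1 PoszD.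
apply: (@infinite_nat); apply: (@sub_finite_set _ _ [set k | C (x + (k%:Z, 0))]).
  by move=> k _; exact: iter.
apply: (@finite_preimage _ _ _ (fun k => x + (k%:Z, 0))) => // k l _ _ /addrI.
by case.
Qed.

Lemma sum_boundaryE (C : set vertex) (g : edge -> R) : finite_set C ->
  \sum_(e \in edge_boundary C) g e = \sum_(e <- fset_set (edge_boundary C)) g e.
Proof. by move=> finC; rewrite fsbig_finite //; exact: finite_edge_boundary. Qed.

(** Undoing the flips replaces non-positive bonds by their opposites, so no boundary sum
    decreases. *)
Lemma local_ground_flip n (F : pred edge) J s :
  local_ground n (flip_couplings F J) s ->
  (forall e, F e -> bond (flip_couplings F J) s e <= 0) ->
  local_ground n J s.
Proof.
move=> gs neg C /gs; rewrite !(sum_boundaryE _ (finite_fset C)) => /le_trans; apply.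
rewrite ler_sum // => e _; have := neg e.
rewrite !bond_sign /flip_couplings; case: (F e) => // /(_ erefl).
by rewrite mulrN oppr_le0 => h; lra.
Qed.

Lemma finite_square n : finite_set (square n).
Proof.
apply: (@sub_finite_set _ _ ((fun k : 'I_n * 'I_n => (k.1%:Z, k.2%:Z)) @` setT)).
  move=> [a b]; rewrite /square /= => h.
  have ha : (`|a|%N < n)%N by lia.
  have hb : (`|b|%N < n)%N by lia.
  by exists (Ordinal ha, Ordinal hb) => //=; congr (_, _); lia.
exact: finite_image.
Qed.

(** Let [C] be the set of disagreement in the square. Across its boundary the bonds of [s1] and [s2]
    are opposite, so the two ground state inequalities force the boundary sum to vanish; genericity
    then leaves no boundary. *)
Lemma local_ground_unique n J s1 s2 : generic J ->
  local_ground n J s1 -> local_ground n J s2 ->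
  (forall x, padded n x -> ~ square n x -> s1 x = s2 x) ->
  forall x, square n x -> s1 x = s2 x.
Proof.
move=> gen gs1 gs2 collar x0 sqx0; apply: contrapT => neq.
pose C : set vertex := square n `&` [set x | s1 x != s2 x].
have finC : finite_set C.
  apply: sub_finite_set (@subIsetl _ _ _) _.
  exact: finite_square.
pose D := fset_set (edge_boundary C).
have finD := finite_edge_boundary finC.
have Csub : [set` fset_set C] `<=` square n by rewrite fset_setK //; exact: subIsetl.
have flipC x : C x -> s2 x = ~~ s1 x.
  by move=> [_ /=]; case: (s1 x); case: (s2 x).
have sameC x : padded n x -> ~ C x -> s2 x = s1 x.
  move=> px nCx; have [sqx|sqx] := pselect (square n x); last by rewrite collar.
  by apply/esym/eqP/negPn/negP => ?; apply: nCx.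
have opp e : e \in D -> bond J s2 e = - bond J s1 e.
  rewrite in_fset_set // inE => bd.
  suff -> : bond J s2 e = (-1) ^+ (~~ (s1 (edge_fst e) (+) s1 (edge_snd e))) * J e.
    by rewrite bond_sign; case: (_ (+) _); rewrite /= ?expr1 ?expr0 ?mulN1r ?mul1r ?opprK.
  rewrite bond_sign; congr (_ ^+ _ * _).
  have pads : padded n (edge_fst e) /\ padded n (edge_snd e).
    case: bd => -[]; rewrite /C /square /padded /edge_fst /edge_snd /=;
      case: e => [[a b] []] /=; lia.
  case: bd => -[h1 h2].
    by rewrite (flipC _ h1) (sameC _ pads.2 h2) addNb.
  by rewrite (sameC _ pads.1 h1) (flipC _ h2) addbN.
have sum0 : \sum_(e <- D) bond J s1 e = 0.
  apply/eqP; rewrite eq_le; apply/andP; split; last first.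
    by have := gs1 _ Csub; rewrite fset_setK // sum_boundaryE.
  rewrite -oppr_ge0 -sumrN -(eq_big_seq _ opp).
  by have := gs2 _ Csub; rewrite fset_setK // sum_boundaryE.
have D0 : D = fset0.
  apply: (@generic_sum J D (fun e => s1 (edge_fst e) (+) s1 (edge_snd e)) gen).
  rewrite -[RHS]sum0.
  by apply: eq_bigr => e _; rewrite bond_sign.
have [e bd] := @edge_boundary_neq0 C x0 finC (conj sqx0 (introN eqP neq)).
have : e \in D by rewrite in_fset_set // inE.
by rewrite D0 inE.
Qed.

(* Both walks minimise the total |J| between their ends, since their symmetric
   difference bounds the finite set [enclosed f ds1 ds2]; genericity excludes
   ties. *)
Lemma unsatisfied_walk_unique n J J1 J2 s1 s2 L f ds1 ds2 : generic J ->
  (forall e, `|J1 e| = `|J e|) -> (forall e, `|J2 e| = `|J e|) ->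
  local_ground n J1 s1 -> local_ground n J2 s2 ->
  (forall x, close_to L f x -> square n x) ->
  (size ds1 <= L)%N -> (size ds2 <= L)%N -> walk_end f ds1 = walk_end f ds2 ->
  uniq (visited f ds1) -> uniq (visited f ds2) ->
  (forall e, e \in crossings f ds1 -> bond J1 s1 e < 0) ->
  (forall e, e \in crossings f ds2 -> bond J2 s2 e < 0) ->
  ds1 = ds2.
Proof.
move=> gen a1 a2 gs1 gs2 sq z1 z2 eend u1 u2 n1 n2.
pose C := enclosed f ds1 ds2.
have Csq : C `<=` square n.
  by move=> x /(enclosed_close z1 z2 eend); exact: sq.
have finC : finite_set C := sub_finite_set Csq (finite_square n).
have finD := finite_edge_boundary finC.
pose D := fset_set (edge_boundary C).
have Csub : [set` fset_set C] `<=` square n by rewrite fset_setK.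
have memD e : e \in D -> (e \in crossings f ds1) (+) (e \in crossings f ds2).
  by rewrite in_fset_set // inE => /edge_boundary_enclosed; apply.
(* The signed sum is the total [|J|] on the edges of [ds2] alone minus that on the edges of [ds1]
   alone. The ground state [s1] shows that it is at least 0, and [s2] that it is at most 0. *)
have le1 e : e \in D ->
    bond J1 s1 e <= (-1) ^+ ((e \in crossings f ds1) (+) (J e < 0)%R) * J e.
  move=> _; rewrite signr_addb -mulrA -normr_sign_mul -a1 -(normr_bond J1 s1).
  case: (boolP (e \in _)) => [/n1 h|_]; last by rewrite mul1r ler_norm.
  by rewrite expr1 mulN1r ltr0_norm // opprK.
have le2 e : e \in D ->
    bond J2 s2 e <= - ((-1) ^+ ((e \in crossings f ds1) (+) (J e < 0)%R) * J e).
  move=> /memD; rewrite signr_addb -mulrA -normr_sign_mul -a2 -(normr_bond J2 s2).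
  case: (boolP (e \in _)) => [_ _|_ /= /n2 h].
    by rewrite expr1 mulN1r opprK ler_norm.
  by rewrite mul1r ltr0_norm // opprK.
have D0 : D = fset0.
  apply: (@generic_sum J _ (fun e => (e \in crossings f ds1) (+) (J e < 0)%R) gen).
  apply/eqP; rewrite eq_le -oppr_ge0 -sumrN; apply/andP; split.
    have := gs2 _ Csub; rewrite fset_setK // sum_boundaryE // => /le_trans; apply.
    by rewrite big_seq [leRHS]big_seq ler_sum.
  have := gs1 _ Csub; rewrite fset_setK // sum_boundaryE // => /le_trans; apply.
  by rewrite big_seq [leRHS]big_seq ler_sum.
apply: (crossings_inj u1 u2) => e.
suff : ~~ ((e \in crossings f ds1) (+) (e \in crossings f ds2)).
  by do 2![case: (e \in _)].
apply/negP => /(edge_boundary_enclosed e u1 u2 eend) bd.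
have : e \in D by rewrite in_fset_set // inE.
by rewrite D0 inE.
Qed.

End ground_states.

(** * Recovering a configuration from flipped couplings *)

Section configurations.
Variables (R : realType) (N L : nat).
Implicit Types (J : couplings R).

Let M := L.*2.+1.
Let n := (N * M)%N.

Definition box := ('I_N * 'I_N)%type.
Definition centre (b : box) : dual_vertex := ((b.1 * M + L)%:Z, (b.2 * M + L)%:Z).

(** The side is [n + 2], with indices shifted by one, because [padded n] runs from -1 to [n]. *)
Definition spin_block := {ffun 'I_n.+2 * 'I_n.+2 -> bool}.
(* Meaningful on [padded n] only: elsewhere [inord] gives an arbitrary index. *)
Definition extend_spins (sigma : spin_block) : spins :=
  fun x => sigma (inord `|(x.1 + 1)%R|%N, inord `|(x.2 + 1)%R|%N).
Definition restrict_spins (s : spins) : spin_block :=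
  [ffun v : 'I_n.+2 * 'I_n.+2 => s (v.1%:Z - 1, v.2%:Z - 1)].

Lemma extend_restrict s x : padded n x -> extend_spins (restrict_spins s) x = s x.
Proof.
case: x => a b; rewrite /padded /extend_spins /= => h; rewrite ffunE /=.
rewrite !inordK; [|lia..].
by congr (s (_, _)); lia.
Qed.

Lemma extend_spins_inj (s1 s2 : spin_block) :
  (forall x, padded n x -> extend_spins s1 x = extend_spins s2 x) -> s1 = s2.
Proof.
move=> h; apply/ffunP => -[i j].
have := h (i%:Z - 1, j%:Z - 1); rewrite /extend_spins /= !subrK !absz_nat !inord_val.
by apply; rewrite /padded /=; have := ltn_ord i; have := ltn_ord j; lia.
Qed.

Lemma close_centre_square b x : close_to L (centre b) x -> square n x.
Proof.
case: b x => i j [a c]; rewrite /close_to /centre /square /=.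
have : (i * M + M <= n)%N by rewrite -mulSnr leq_mul2r ltn_ord orbT.
have : (j * M + M <= n)%N by rewrite -mulSnr leq_mul2r ltn_ord orbT.
rewrite /M; move: (i * _)%N (j * _)%N n => u v w; lia.
Qed.

(** As [M] is [2L + 1], the boxes of radius [L] tile the square: Euclidean division of the
    coordinates of [x] by [M] recovers the box. *)
Lemma close_centre_inj b b' x :
  close_to L (centre b) x -> close_to L (centre b') x -> b = b'.
Proof.
have aux (i i' : 'I_N) (a : int) : (`|(a - (i * M + L)%:Z)%R| <= L)%N ->
    (`|(a - (i' * M + L)%:Z)%R| <= L)%N -> i = i'.
  move=> h h'; apply/val_inj => /=.
  have -> : val i = (`|a|%N %/ M)%N.
    apply/esym; have -> : `|a|%N = (i * M + (`|a|%N - i * M))%N.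
      by move: h; move: (i * M)%N => u; lia.
    rewrite divnMDl // divn_small ?addn0 //.
    by move: h; rewrite /M; move: (i * _)%N => u; lia.
  apply/esym; have -> : `|a|%N = (i' * M + (`|a|%N - i' * M))%N.
    by move: h'; move: (i' * M)%N => u; lia.
  rewrite divnMDl // divn_small ?addn0 //.
  by move: h'; rewrite /M; move: (i' * _)%N => u; lia.
case: b b' x => i j [i' j'] [a c]; rewrite /close_to /centre /=.
by move=> /andP[h1 h2] /andP[h3 h4]; rewrite (aux _ _ _ h1 h3) (aux _ _ _ h2 h4).
Qed.

Definition walk_family := {ffun box -> option (L.-tuple dir)}.
Definition configuration := (spin_block * walk_family)%type.

(** A box sent to [None] carries no constraint, so the same couplings may realize several
    configurations. *)
Definition realizes J (c : configuration) :=
  local_ground n J (extend_spins c.1) /\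
  forall b t, c.2 b = Some t -> uniq (visited (centre b) t) /\
    forall e, e \in crossings (centre b) t -> bond J (extend_spins c.1) e < 0.

Definition step := (box * 'I_L)%type.
Definition steps (k : walk_family) : {set step} := [set p | k p.1 != None].
(** The default [(0, false)] is never reached for [p] in [steps k], where the list of crossings has
    length [L]. *)
Definition edge_at (k : walk_family) (p : step) : edge :=
  if k p.1 is Some t then nth (0, false) (crossings (centre p.1) t) p.2
  else (0, false).
Definition flipped k (S : {set step}) : pred edge :=
  fun e => [exists p in S, edge_at k p == e].

Definition code_type : finType :=
  ({ffun 'I_4 * 'I_n.+2 -> bool} * {ffun box -> option {ffun dir -> 'I_L.+1}})%type.
(** The four sides of the block make up the collar [padded n] minus [square n]; the corners are
    stored twice. *)
Definition sides (sigma : spin_block) : {ffun 'I_4 * 'I_n.+2 -> bool} :=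
  [ffun p => sigma (match val p.1 with
    | 0 => (ord0, p.2) | 1 => (ord_max, p.2) | 2 => (p.2, ord0) | _ => (p.2, ord_max)
    end)].
(* The number of steps in each direction determines the end of a walk. *)
Definition code (c : configuration) : code_type :=
  (sides c.1, [ffun b => omap (fun t : L.-tuple dir =>
     [ffun d => inord (count_mem d t)]) (c.2 b)]).

Lemma edge_at_crossings (k : walk_family) b (t : L.-tuple dir) (l : 'I_L) :
  k b = Some t -> edge_at k (b, l) \in crossings (centre b) t.
Proof.
by rewrite /edge_at /= => ->; rewrite mem_nth // size_crossings size_tuple.
Qed.

(** Walks from different centres stay in disjoint boxes, and a single self-avoiding walk crosses
    distinct edges. *)
Lemma edge_at_inj J c : realizes J c -> {in steps c.2 &, injective (edge_at c.2)}.
Proof.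
move=> [_ real] [b l] [b' l']; rewrite !inE /=.
case kb : (c.2 b) => [t|//] _; case kb' : (c.2 b') => [t'|//] _ ee.
have near1 bb tt e : c.2 bb = Some tt -> e \in crossings (centre bb) tt ->
    close_to L (centre bb) (dual_fst e).
  by move=> kbb /crossings_visited/andP[/visited_close]; rewrite size_tuple.
have bE : b = b'.
  apply: (@close_centre_inj _ _ (dual_fst (edge_at c.2 (b, l)))).
    by apply: near1 (edge_at_crossings l kb).
  by rewrite ee; apply: near1 (edge_at_crossings l' kb').
subst b'; congr (_, _); apply/val_inj/eqP => /=.
have [/crossings_uniq u _] := real _ _ kb.
move/eqP: ee; rewrite /edge_at /= kb.
by rewrite nth_uniq // size_crossings size_tuple.
Qed.

Lemma sides_collar (s1 s2 : spin_block) x : sides s1 = sides s2 ->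
  padded n x -> ~ square n x -> extend_spins s1 x = extend_spins s2 x.
Proof.
move=> /ffunP eqs; case: x => a b; rewrite /padded /square /extend_spins /= => px nsq.
have [h|[h|[h|h]]] : a = -1 \/ a = n%:Z \/ b = -1 \/ b = n%:Z by lia.
- have := eqs (@Ordinal 4 0 isT, inord `|(b + 1)%R|%N); rewrite !ffunE /=.
  by rewrite h (_ : inord `|(-1 + 1)%R|%N = ord0) //; apply/val_inj; rewrite /= inordK.
- have := eqs (@Ordinal 4 1 isT, inord `|(b + 1)%R|%N); rewrite !ffunE /=.
  rewrite h (_ : inord `|(n%:Z + 1)%R|%N = ord_max) //.
  by apply/val_inj; rewrite /= inordK; lia.
- have := eqs (@Ordinal 4 2 isT, inord `|(a + 1)%R|%N); rewrite !ffunE /=.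
  by rewrite h (_ : inord `|(-1 + 1)%R|%N = ord0) //; apply/val_inj; rewrite /= inordK.
- have := eqs (@Ordinal 4 3 isT, inord `|(a + 1)%R|%N); rewrite !ffunE /=.
  rewrite h (_ : inord `|(n%:Z + 1)%R|%N = ord_max) //.
  by apply/val_inj; rewrite /= inordK; lia.
Qed.

Lemma realizes_flipped_local_ground J c (S : {set step}) : S \subset steps c.2 ->
  realizes (flip_couplings (flipped c.2 S) J) c ->
  local_ground n J (extend_spins c.1).
Proof.
move=> /fintype.subsetP sub [gs real]; apply: local_ground_flip gs _ => e.
case/existsP => -[b l] /andP[/sub]; rewrite inE /=.
case kb : (c.2 b) => [t|//] _ /eqP <-.
by apply/ltW/(real b t kb).2/edge_at_crossings.
Qed.

(** Every walk edge is unsatisfied for the flipped couplings, so for [J] itself the satisfied ones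
    are exactly those that were flipped. This reads [S] off from [J], the spins and the walks. *)
Lemma mem_flip_set J c (S : {set step}) p : S \subset steps c.2 ->
  realizes (flip_couplings (flipped c.2 S) J) c -> p \in steps c.2 ->
  (p \in S) = (0 < bond J (extend_spins c.1) (edge_at c.2 p)).
Proof.
move=> /fintype.subsetP sub real pS.
have -> : (p \in S) = flipped c.2 S (edge_at c.2 p).
  apply/idP/existsP => [?|[q /andP[qS /eqP qp]]]; first by exists p; apply/andP.
  by rewrite -(edge_at_inj real (sub _ qS) pS qp).
have : bond (flip_couplings (flipped c.2 S) J) (extend_spins c.1) (edge_at c.2 p) < 0.
  case: p pS => b l; rewrite inE /=; case kb : (c.2 b) => [t|//] _.
  by apply/(real.2 b t kb).2/edge_at_crossings.
rewrite !bond_sign /flip_couplings; case: flipped => h.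
  by move: h; rewrite mulrN oppr_lt0 => ->.
by rewrite lt_gtF.
Qed.

(** The data are recovered in order: the spins, since both blocks are ground states for the same [J]
    with the same collar; then each walk from its end, since flips preserve [|J|] and hence the
    geodesics; then the flipped subset, from the signs of the bonds. *)
Lemma code_inj J (c1 c2 : configuration) (S1 S2 : {set step}) : generic J ->
  S1 \subset steps c1.2 -> S2 \subset steps c2.2 ->
  realizes (flip_couplings (flipped c1.2 S1) J) c1 ->
  realizes (flip_couplings (flipped c2.2 S2) J) c2 ->
  code c1 = code c2 -> (c1, S1) = (c2, S2).
Proof.
move=> gen sub1 sub2 real1 real2 [eqs eqw].
have gs1 := realizes_flipped_local_ground sub1 real1.
have gs2 := realizes_flipped_local_ground sub2 real2.
have sigE : c1.1 = c2.1.
  apply: extend_spins_inj => x px; have [sqx|nsqx] := pselect (square n x).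
    apply: (local_ground_unique gen gs1 gs2) => // y; exact: sides_collar.
  exact: sides_collar.
have absflip F e : `|flip_couplings F J e| = `|J e|.
  by rewrite /flip_couplings; case: (F e); rewrite ?normrN.
have walkE : c1.2 = c2.2.
  apply/ffunP => b; move/ffunP: eqw => /(_ b); rewrite !ffunE.
  case kb1 : (c1.2 b) => [t1|]; case kb2 : (c2.2 b) => [t2|] //= -[] /ffunP eqt.
  (* A direction occurs at most [L] times in a walk of length [L], so [inord] loses nothing. *)
  have cnt d : count_mem d t1 = count_mem d t2.
    have le (t : L.-tuple dir) : (count_mem d t < L.+1)%N.
      by rewrite ltnS -[leqRHS](size_tuple t) count_size.
    by have := eqt d; rewrite !ffunE => /(congr1 val); rewrite /= !inordK.
  have [u1 n1] := real1.2 _ _ kb1; have [u2 n2] := real2.2 _ _ kb2.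
  congr Some; apply/val_inj => /=.
  apply: (unsatisfied_walk_unique gen (absflip _) (absflip _) real1.1 real2.1
    (@close_centre_square b)) n1 n2; rewrite ?size_tuple //.
  by rewrite !walk_end_count !cnt.
have cE : c1 = c2.
  by rewrite [c1]surjective_pairing sigE walkE -surjective_pairing.
subst c2; congr (_, _); apply/setP => p.
case: (boolP (p \in steps c1.2)) => pS.
  by rewrite (mem_flip_set sub1 real1 pS) (mem_flip_set sub2 real2 pS).
by rewrite (contraNF (fintype.subsetP sub1 p) pS) (contraNF (fintype.subsetP sub2 p) pS).
Qed.

End configurations.

(** * The law of the couplings *)

Section product_spaces.
Context d (I : choiceType) (T : measurableType d).

Definition cylinder (F : {fset I}) (A : I -> set T) : set (product_space I T) :=
  \bigcap_(i in [set` F]) (fun f => f i) @^-1` A i.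

Lemma measurable_coordinate (i : I) :
  measurable_fun setT (fun f : product_space I T => f i).
Proof.
move=> _ A mA; rewrite setTI; apply: sub_sigma_algebra.
by exists i => //; exists A => //; rewrite setTI.
Qed.

Lemma measurable_to_product d0 (T0 : measurableType d0) (X : T0 -> product_space I T) :
  (forall i, measurable_fun setT (fun t => X t i)) -> measurable_fun setT X.
Proof.
move=> mX.
apply: (@measurability _ _ _ (product_space I T) _ _
  (@product_generators d I T) erefl).
move=> _ [_ [i _ [A mA <-]] <-]; rewrite !setTI -[X in measurable X]setTI.
exact: (mX i).
Qed.

Lemma measurable_cylinder F A : (forall i, measurable (A i)) ->
  measurable (cylinder F A).
Proof.
move=> mA; apply: fin_bigcap_measurable => // i _.
by rewrite -[X in measurable X]setTI; exact: measurable_coordinate.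
Qed.

Let cylinders : set (set (product_space I T)) :=
  [set C | exists F A, (forall i, measurable (A i)) /\ C = cylinder F A].

(** Cylinders are closed under intersection, contain the whole space and generate the product
    sigma-algebra. General finite measures are allowed because restricted and scaled ones occur
    below. *)
Lemma cylinder_measure_unique (R : realType)
  (m1 m2 : {measure set (product_space I T) -> \bar R}) :
  (m1 setT < +oo)%E ->
  (forall F A, (forall i, measurable (A i)) -> m1 (cylinder F A) = m2 (cylinder F A)) ->
  forall E, measurable E -> m1 E = m2 E.
Proof.
move=> fin1 eqm E mE.
apply: (measure_unique cylinders (fun=> setT)) => //.
- apply/seteqP; split.
    apply: smallest_sub; first exact: smallest_sigma_algebra.
    move=> _ [i _ [A mA <-]]; apply: sub_sigma_algebra.
    exists [fset i]%fset, (fun=> A); split => //; rewrite setTI /cylinder.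
    by rewrite set_fset1 bigcap_set1.
  apply: smallest_sub; first exact: smallest_sigma_algebra.
  by move=> _ [F [A [mA ->]]]; exact: measurable_cylinder.
- move=> _ _ [F [A [mA ->]]] [G [B [mB ->]]].
  exists (F `|` G)%fset, (fun i => (if i \in F then A i else setT) `&`
                                   (if i \in G then B i else setT)); split.
    by move=> i; apply: measurableI; case: ifP.
  apply/seteqP; split => f /=.
    move=> [fA fB] i /= _; split; case: ifP => // iF; [exact: fA|exact: fB].
  move=> h; split => i /= iF; have := h i; rewrite /= inE iF ?orbT => hi.
    exact: (hi isT).1.
  exact: (hi isT).2.
- move=> _; exists fset0, (fun=> setT); split => //.
  by apply/seteqP; split => f // _ i.
- by rewrite bigcup_const.
- by move=> _ [F [A [mA ->]]]; exact: eqm.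
Qed.

End product_spaces.

Section coupling_law.
Context (R : realType) d0 (T0 : measurableType d0) (P : probability T0 R).
Variables (nu : probability (measurableTypeR R) R) (X : T0 -> couplings R).
Hypothesis mX : measurable_fun setT X.
Hypothesis iidX : iid_with_law P nu (fun e t => X t e).

Let mXpre A : measurable A -> measurable (X @^-1` A).
Proof. by move=> mA; rewrite -[Y in measurable Y]setTI; exact: mX. Qed.

Lemma measurable_flip_couplings F :
  measurable_fun setT (@flip_couplings R F).
Proof.
apply: measurable_to_product => e; rewrite /flip_couplings.
case: (F e); last exact: measurable_coordinate.
by apply: measurableT_comp => //; exact: measurable_coordinate.
Qed.

(** On a cylinder, independence factorises both sides, and a flip only replaces some factors by
    their reflections, of equal [nu]-measure. *)
Lemma law_flip_invariant (F : pred edge) A : symmetric_law nu -> measurable A ->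
  P (X @^-1` (flip_couplings F @^-1` A)) = P (X @^-1` A).
Proof.
move=> sym mA.
have mF : measurable_fun setT (flip_couplings F \o X).
  by apply: measurableT_comp => //; exact: measurable_flip_couplings.
pose X1 : {mfun T0 >-> couplings R} := HB.pack X (isMeasurableFun.Build _ _ _ _ X mX).
pose X2 : {mfun T0 >-> couplings R} :=
  HB.pack (flip_couplings F \o X) (isMeasurableFun.Build _ _ _ _ _ mF).
change (distribution P X2 A = distribution P X1 A).
apply: cylinder_measure_unique => //.
  by apply: (@le_lt_trans _ _ 1%E); rewrite ?probability_le1 ?ltry.
move=> G B mB.
change (P ((flip_couplings F \o X) @^-1` cylinder G B) = P (X @^-1` cylinder G B)).
pose B' (e : edge) : set (measurableTypeR R) :=
  if F e then (fun x : R => - x) @^-1` (B e) else B e.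
have mB' e : measurable (B' e).
  rewrite /B'; case: (F e) => //; rewrite -[Y in measurable Y]setTI.
  exact: (@oppr_measurable R setT measurableT _ (mB e)).
apply: (@etrans _ _ (P (X @^-1` cylinder G B'))).
  congr (P _); apply/seteqP; split => t h i /= iG; have := h i iG;
  by rewrite /B' /= /flip_couplings; case: (F i).
rewrite /cylinder !preimage_bigcap.
rewrite (iidX.2 G B' mB') (iidX.2 G B mB).
apply: eq_bigr => e _; rewrite (iidX.1 e _ (mB' e)) (iidX.1 e _ (mB e)) /B'.
by case: (F e) => //; exact: sym.
Qed.

End coupling_law.

(** * Almost sure genericity of i.i.d. couplings with an atomless law *)

Section generic_couplings.
Context (R : realType) d0 (T0 : measurableType d0) (P : probability T0 R).
Variables (nu : probability (measurableTypeR R) R) (X : T0 -> couplings R).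
Hypothesis mX : measurable_fun setT X.
Hypothesis iidX : iid_with_law P nu (fun e t => X t e).

Let mXpre A : measurable A -> measurable (X @^-1` A).
Proof. by move=> mA; rewrite -[Y in measurable Y]setTI; exact: mX. Qed.

(** A stand-in for the restriction to the edges other than [e0] that stays in the same product
    space. *)
Definition zero_at (e0 : edge) (J : couplings R) : couplings R :=
  fun e => if e == e0 then 0 else J e.

Lemma measurable_zero_at e0 : measurable_fun setT (zero_at e0).
Proof.
apply: measurable_to_product => e; rewrite /zero_at.
by case: (e == e0); [exact: measurable_cst | exact: measurable_coordinate].
Qed.

Let mXe e A : measurable A -> measurable ((fun t => X t e) @^-1` A).
Proof.
move=> mA; apply: (mXpre (A := (fun J : couplings R => J e) @^-1` A)).
by rewrite -[Y in measurable Y]setTI; exact: measurable_coordinate.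
Qed.

(** For fixed [A] both sides are finite measures in [B], so it is enough to compare them on
    cylinders. *)
Lemma coordinate_independent e0 (A : set (measurableTypeR R)) (B : set (couplings R)) :
  measurable A -> measurable B ->
  P ((zero_at e0 \o X) @^-1` B `&` (fun t => X t e0) @^-1` A) =
  (nu A * P ((zero_at e0 \o X) @^-1` B))%E.
Proof.
move=> mA mB.
have mZ : measurable_fun setT (zero_at e0 \o X).
  by apply: measurableT_comp => //; exact: measurable_zero_at.
have mA' := mXe e0 mA.
pose Z : {mfun T0 >-> couplings R} :=
  HB.pack (zero_at e0 \o X) (isMeasurableFun.Build _ _ _ _ _ mZ).
have nuA0 : (0 <= fine (nu A))%R by rewrite fine_ge0.
have finA : nu A \is a fin_num by exact: fin_num_measure.
rewrite -[nu A]fineK //.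
pose m1 := (pushforward (mrestr P mA') (zero_at e0 \o X) :
  {measure set (couplings R) -> \bar R}).
pose m2 : {measure set (couplings R) -> \bar R} :=
  mscale (NngNum nuA0) (distribution P Z).
change (m1 mZ B = m2 B).
apply: cylinder_measure_unique => //.
  rewrite /m1 /= /pushforward /mrestr; apply: (@le_lt_trans _ _ 1%E); last exact: ltry.
  by apply: probability_le1; rewrite preimage_setT setTI.
move=> G C mC.
change (P ((zero_at e0 \o X) @^-1` cylinder G C `&` (fun t => X t e0) @^-1` A) =
  ((fine (nu A))%:E * P ((zero_at e0 \o X) @^-1` cylinder G C))%E).
rewrite fineK //.
have [h|h] := pselect (e0 \in G -> C e0 0); last first.
  suff -> : (zero_at e0 \o X) @^-1` cylinder G C = set0 by rewrite set0I measure0 mule0.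
  apply/seteqP; split => t // tC; apply: h => eG.
  by have := tC e0 eG; rewrite /zero_at /= eqxx.
have -> : (zero_at e0 \o X) @^-1` cylinder G C = X @^-1` cylinder (G `\ e0)%fset C.
  apply/seteqP; split => t tC e /=.
    by rewrite !inE => /andP[ee eG]; have := tC e eG; rewrite /= /zero_at (negPf ee).
  move=> eG; rewrite /zero_at; case: eqP => [ee|/eqP ee]; first by subst e; exact: h.
  by apply: tC; rewrite /= !inE ee.
pose C' (e : edge) : set (measurableTypeR R) := if e == e0 then A else C e.
have mC' e : measurable (C' e) by rewrite /C'; case: ifP.
have -> : X @^-1` cylinder (G `\ e0)%fset C `&` (fun t => X t e0) @^-1` A =
    \bigcap_(e in [set` (e0 |` G `\ e0)%fset]) (fun t => X t e) @^-1` C' e.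
  apply/seteqP; split => t.
    move=> [tC tA] e /=; rewrite !inE /C'; case: eqP => [->//|/eqP ee /= eG].
    by apply: tC; rewrite /= !inE ee.
  move=> tC; split; last by have := tC e0; rewrite /= /C' eqxx !inE eqxx; apply.
  move=> e /= eG; have := tC e; rewrite /C' /= inE eG orbT => /(_ isT).
  by move: eG; rewrite !inE => /andP[/negPf->].
rewrite (iidX.2 _ C' mC') big_fsetU1 ?inE ?eqxx //=.
rewrite {1}/C' eqxx (iidX.1 e0 _ mA); congr (_ * _)%E.
rewrite /cylinder preimage_bigcap (iidX.2 _ C mC).
rewrite big_seq [RHS]big_seq; apply: eq_bigr => e.
by rewrite !inE /C' => /andP[/negPf-> _].
Qed.

(** The coupling at [e0] and the remaining ones have a product law, and the graph of [Y] has
    one-point sections, which are [nu]-null. *)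
Lemma coordinate_atomless e0 (Y : couplings R -> R) : continuous_law nu ->
  measurable_fun setT Y -> (forall J, Y (zero_at e0 J) = Y J) ->
  P [set t | X t e0 = Y (X t)] = 0%E.
Proof.
move=> cont mY Y0.
have mZ : measurable_fun setT (zero_at e0 \o X).
  by apply: measurableT_comp => //; exact: measurable_zero_at.
pose Z : {mfun T0 >-> couplings R} :=
  HB.pack (zero_at e0 \o X) (isMeasurableFun.Build _ _ _ _ _ mZ).
have mW : measurable_fun setT (fun t => (zero_at e0 (X t), X t e0 : measurableTypeR R)).
  by apply/measurable_fun_pair; [exact: mZ |
    exact: (measurableT_comp (measurable_coordinate e0) mX)].
pose W : {mfun T0 >-> (couplings R * measurableTypeR R)%type} :=
  HB.pack (fun t => (zero_at e0 (X t), X t e0 : measurableTypeR R))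
    (isMeasurableFun.Build _ _ _ _ _ mW).
pose D : set (couplings R * measurableTypeR R) := [set p | p.2 = Y p.1].
have mD : measurable D.
  have mf : measurable_fun setT
      (fun p : couplings R * measurableTypeR R => p.2 - Y p.1 : measurableTypeR R).
    apply: measurable_funB; first exact: measurable_snd.
    by apply: measurableT_comp => //; exact: measurable_fst.
  rewrite (_ : D = setT `&` (fun p => p.2 - Y p.1) @^-1` [set 0]); first exact: mf.
  rewrite setTI; apply/seteqP; split => p /= => [->|/eqP]; first by rewrite subrr.
  by rewrite subr_eq0 => /eqP.
transitivity (distribution P W D).
  congr (P _); apply/funext => t.
  by change ((X t e0 = Y (X t)) = (X t e0 = Y (zero_at e0 (X t)))); rewrite Y0.
rewrite -(product_measure_unique (m1 := distribution P Z) (m2 := nu)) //.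
  rewrite /= /product_measure1; apply: integral0_eq => J _ /=.
  rewrite (_ : xsection D J = [set Y J]) ?cont //.
  by apply/seteqP; split => y; rewrite /xsection /D /= inE.
move=> B A mB mA; rewrite muleC -(coordinate_independent e0 mA mB).
by congr (P _).
Qed.

(** Solving the equation for the coupling at some [e0] in [D] prescribes it as a function [Y] of the
    others. *)
Lemma signed_sum_neq0 (D F : {fset edge}) : continuous_law nu -> D != fset0 ->
  P [set t | \sum_(e <- D) (-1) ^+ (e \in F) * X t e = 0] = 0%E.
Proof.
move=> cont /fset0Pn[e0 e0D].
pose Y (J : couplings R) : R :=
  - (-1) ^+ (e0 \in F) * \sum_(e <- (D `\ e0)%fset) (-1) ^+ (e \in F) * J e.
rewrite -(@coordinate_atomless e0 Y) //.
- congr (P _); apply/seteqP; split => t /=; rewrite (big_fsetD1 e0) //= /Y;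
  move: (\sum_(_ <- _) _) => S; case: (e0 \in F); rewrite ?expr1 ?expr0; lra.
- apply: measurable_funM; first exact: measurable_cst.
  apply: measurable_sum => e; apply: measurable_funM; first exact: measurable_cst.
  exact: measurable_coordinate.
- move=> J; congr (_ * _); rewrite big_seq [RHS]big_seq; apply: eq_bigr => e.
  by rewrite !inE /zero_at => /andP[/negPf-> _].
Qed.

Lemma ae_generic : continuous_law nu -> {ae P, forall t, generic (X t)}.
Proof.
move=> cont.
pose B (p : {fset edge} * {fset edge}) : set T0 :=
  if p.1 == fset0 then set0
  else [set t | \sum_(e <- p.1) (-1) ^+ (e \in p.2) * X t e = 0].
have mB p : measurable (B p).
  rewrite /B; case: ifP => // _.
  rewrite (_ : [set t | _] =
    (fun t => \sum_(e <- p.1) (-1) ^+ (e \in p.2) * X t e) @^-1` [set 0]) //.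
  rewrite -[S in measurable S]setTI.
  suff : measurable_fun setT (fun t => \sum_(e <- p.1) (-1) ^+ (e \in p.2) * X t e : R).
    by apply.
  apply: measurable_sum => e; apply: measurable_funM; first exact: measurable_cst.
  by apply: (measurableT_comp (measurable_coordinate e) mX).
change (P.-negligible (~` [set t | generic (X t)])).
pose G k := if (choice.unpickle k : option ({fset edge} * {fset edge})) is Some p
  then B p else set0.
apply: (@negligibleS _ _ _ P (\bigcup_k G k)).
  move=> t /=; rewrite /generic => /existsNP[D /existsNP[F]].
  move=> /not_implyP[D0 /negP/negPn/eqP tD].
  by exists (choice.pickle (D, F)) => //; rewrite /G choice.pickleK /B /= (negPf D0).
apply: negligible_bigcup => k; rewrite /G.
case: choice.unpickle => [p|]; last exact: negligible_set0.
apply/negligibleP => //; rewrite /B; case: eqP => [|/eqP p0]; first by rewrite measure0.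
exact: signed_sum_neq0.
Qed.

End generic_couplings.

(** * Measurability *)

Section measurable_quantifiers.
Context d (T : measurableType d).

Lemma measurable_forall (U : countType) (A : U -> set T) :
  (forall u, measurable (A u)) -> measurable [set t | forall u, A u t].
Proof.
move=> mA; rewrite (_ : [set t | _] = ~` \bigcup_u ~` A u).
  apply: measurableC; apply: countable_bigcupT_measurable => [|u].
    exact: countableP.
  exact: measurableC.
rewrite setC_bigcup; apply/seteqP; split => t At u => [_|]; rewrite ?setCK //.
by have := At u I; rewrite setCK.
Qed.

Lemma measurable_exists (U : countType) (A : U -> set T) :
  (forall u, measurable (A u)) -> measurable [set t | exists u, A u t].
Proof.
move=> mA; rewrite (_ : [set t | _] = \bigcup_u A u).
  apply: countable_bigcupT_measurable => //; exact: countableP.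
by apply/seteqP; split => t [u]; exists u.
Qed.

Lemma measurable_imply (Q : Prop) (A : set T) : (Q -> measurable A) ->
  measurable [set t | Q -> A t].
Proof.
move=> mA; have [q|nq] := pselect Q.
  rewrite (_ : [set t | _] = A); first exact: mA.
  by apply/seteqP; split => t /=; [apply|].
rewrite (_ : [set t | _] = setT) //.
by apply/seteqP; split => t // _ /nq.
Qed.

Lemma measurable_prop (Q : Prop) : measurable [set _ : T | Q].
Proof.
have [q|nq] := pselect Q.
  by rewrite (_ : [set _ | _] = setT) //; apply/seteqP; split.
by rewrite (_ : [set _ | _] = set0) //; apply/seteqP; split.
Qed.

Lemma measurable_lt0 (R : realType) (f : T -> R) : measurable_fun setT f ->
  measurable [set t | f t < 0].
Proof.
move=> mf; rewrite (_ : [set t | _] = setT `&` f @^-1` [set` `]-oo, 0[]).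
  exact: mf _ _ (measurable_itv _).
by rewrite setTI; apply/seteqP; split => t /=; rewrite in_itv.
Qed.

Lemma measurable_ge0 (R : realType) (f : T -> R) : measurable_fun setT f ->
  measurable [set t | 0 <= f t].
Proof.
move=> mf; rewrite (_ : [set t | _] = ~` [set t | f t < 0]).
  by apply: measurableC; exact: measurable_lt0.
by apply/seteqP; split => t /=; rewrite leNgt => /negP.
Qed.

End measurable_quantifiers.

Section measurable_configurations.
Variable R : realType.

Lemma measurable_bond (s : spins) e :
  measurable_fun setT (fun J : couplings R => bond J s e).
Proof.
rewrite (_ : (fun J => _) =
    (fun J : couplings R => (-1) ^+ (s (edge_fst e) (+) s (edge_snd e)) * J e)).
  by apply: measurable_funM; [exact: measurable_cst | exact: measurable_coordinate].
by apply/funext => J; rewrite bond_sign.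
Qed.

Lemma measurable_realizes N L (c : configuration N L) :
  measurable [set J : couplings R | realizes J c].
Proof.
rewrite (_ : [set J | _] =
  [set J | local_ground (N * L.*2.+1)%N J (extend_spins c.1)] `&`
  [set J | forall p : box N * L.-tuple dir, c.2 p.1 = Some p.2 ->
    uniq (visited (centre L p.1) p.2) /\
    forall e : edge, e \in crossings (centre L p.1) p.2 ->
      bond J (extend_spins c.1) e < 0]); last first.
  apply/seteqP; split => J [gs h]; split => //; first by move=> [b t]; exact: h.
  by move=> b t; exact: (h (b, t)).
apply: measurableI.
  rewrite /local_ground; apply: measurable_forall => C; apply: measurable_imply => _.
  apply: measurable_ge0.
  rewrite (_ : (fun J => _) = (fun J => \sum_(e <- fset_set (edge_boundary [set` C]))
      bond J (extend_spins c.1) e)).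
    by apply: measurable_sum => e; exact: measurable_bond.
  by apply/funext => J; rewrite (sum_boundaryE _ (finite_fset C)).
apply: measurable_forall => p; apply: measurable_imply => _.
apply: measurableI; first exact: measurable_prop.
apply: measurable_forall => e; apply: measurable_imply => _.
by apply: measurable_lt0; exact: measurable_bond.
Qed.

Lemma bond_global_flip (J : couplings R) s e : bond J (global_flip s) e = bond J s e.
Proof. by rewrite !bond_sign /global_flip addNb addbN negbK. Qed.

Lemma unsatisfiedE (J : couplings R) (P : spin_pairs) s e : pair_set P s ->
  unsatisfied J P e <-> bond J s e < 0.
Proof.
move=> Ps; split => [[s' Ps']|]; last by exists s.
have [s0 P0] := pair_setP P; move: Ps Ps'; rewrite P0.
by move=> [->|->] [->|->]; rewrite ?bond_global_flip.
Qed.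

(** This is a property of the pair alone. With the sign of the coupling it decides whether the edge
    is unsatisfied, which reduces measurability to each factor of the product. *)
Definition agreeing (e : edge) : set spin_pairs :=
  [set P | exists2 s, pair_set P s & s (edge_fst e) = s (edge_snd e)].

Lemma agreeingE (P : spin_pairs) s e : pair_set P s ->
  agreeing e P <-> s (edge_fst e) = s (edge_snd e).
Proof.
move=> Ps; split => [[s' Ps']|]; last by exists s.
have [s0 P0] := pair_setP P; move: Ps Ps'; rewrite P0 /global_flip.
by move=> [->|->] [->|->] //; [move=> /negb_inj | move=> ->].
Qed.

Lemma measurable_agreeing e : measurable (agreeing e).
Proof.
apply/measurable_spin_pairsE.
pose A x b : set spins := (fun s : spins => s x) @^-1` [set b].
have mA x b : measurable (A x b).
  by rewrite -[X in measurable X]setTI; exact: measurable_coordinate.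
rewrite (_ : _ @^-1` _ = (A (edge_fst e) true `&` A (edge_snd e) true) `|`
                         (A (edge_fst e) false `&` A (edge_snd e) false)).
  by apply: measurableU; apply: measurableI.
have pairs s : pair_set (pair_of s) s by left.
apply/seteqP; split => s.
  move=> /(agreeingE _ (pairs s)); rewrite /A /=.
  by case: (s _); case: (s _) => // _; [left|right].
by move=> h; apply/(agreeingE _ (pairs s)); case: h => -[]; rewrite /A /= => -> ->.
Qed.

Lemma measurable_unsatisfied e :
  measurable [set w : couplings R * spin_pairs | unsatisfied w.1 w.2 e].
Proof.
have mJ : measurable_fun setT (fun w : couplings R * spin_pairs => w.1 e).
  exact: (measurableT_comp (measurable_coordinate e) measurable_fst).
have mag : measurable [set w : couplings R * spin_pairs | agreeing e w.2].
  rewrite -[X in measurable X]setTI.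
  by apply: (@measurable_snd _ _ (couplings R) spin_pairs) => //; exact: measurable_agreeing.
rewrite (_ : [set w | _] =
   ([set w : couplings R * spin_pairs | agreeing e w.2] `&` [set w | w.1 e < 0]) `|`
   (~` [set w : couplings R * spin_pairs | agreeing e w.2] `&` [set w | - w.1 e < 0])).
  apply: measurableU; apply: measurableI => //.
  - exact: measurable_lt0.
  - exact: measurableC.
  - by apply: measurable_lt0; exact: measurable_funN.
apply/seteqP; split => -[J P] /=.
  have [s Ps] : exists s, pair_set P s by have [s ->] := pair_setP P; exists s; left.
  move/(unsatisfiedE _ _ Ps); rewrite bond_sign.
  have [ag|nag] := pselect (agreeing e P).
    by move: (ag) => /(agreeingE _ Ps) ->; rewrite addbb mul1r; left.
  have -> : s (edge_fst e) (+) s (edge_snd e) = true.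
    by apply/negPn/negP => h; apply: nag; apply/(agreeingE _ Ps); move: h; do 2 case: (s _).
  by rewrite expr1 mulN1r; right.
have [s Ps] : exists s, pair_set P s by have [s ->] := pair_setP P; exists s; left.
move=> h; apply/(unsatisfiedE _ _ Ps); rewrite bond_sign; case: h => -[].
  by move=> /(agreeingE _ Ps) ->; rewrite addbb mul1r.
move=> nag; have -> : s (edge_fst e) (+) s (edge_snd e) = true.
  by apply/negPn/negP => h; apply: nag; apply/(agreeingE _ Ps); move: h; do 2 case: (s _).
by rewrite expr1 mulN1r.
Qed.

(** The event E_L for walks started at the face [f]. *)
Definition walk_event f L : set (couplings R * spin_pairs) :=
  [set w : couplings R * spin_pairs | exists t : L.-tuple dir,
    uniq (visited f t) /\
    forall e, e \in crossings f t -> unsatisfied w.1 w.2 e].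

Lemma measurable_walk_event f L : measurable (walk_event f L).
Proof.
apply: measurable_exists => t; apply: measurableI; first exact: measurable_prop.
apply: measurable_forall => e; apply: measurable_imply => _.
exact: measurable_unsatisfied.
Qed.

End measurable_configurations.

(** * Walks under translation and truncation, and their relation to percolation *)

Lemma move_add f a d : move (f + a) d = move f d + a.
Proof. by rewrite /move; case: d.2; rewrite addrAC. Qed.

Lemma crossed_add f a d : crossed (f + a) d = ((crossed f d).1 + a, (crossed f d).2).
Proof. by rewrite /crossed /=; case: d.2 => //; rewrite addrAC. Qed.

Lemma visited_add f a ds : visited (f + a) ds = map (fun h => h + a) (visited f ds).
Proof.
elim: ds f => //= d ds IH f; rewrite /visited /= move_add; congr cons.
exact: (IH (move f d)).
Qed.

Lemma crossings_add f a ds :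
  crossings (f + a) ds = map (fun e => (e.1 + a, e.2)) (crossings f ds).
Proof. by elim: ds f => //= d ds IH f; rewrite crossed_add move_add IH. Qed.

Lemma crossings_take f k ds : crossings f (take k ds) = take k (crossings f ds).
Proof. by elim: ds f k => [|d ds IH] f [|k] //=; rewrite IH. Qed.

Lemma visited_take f k ds : visited f (take k ds) = take k.+1 (visited f ds).
Proof.
rewrite /visited /=; congr cons.
by elim: ds f k => [|d ds IH] f [|k] //=; rewrite IH.
Qed.

Section percolation.
Variable R : realType.

Lemma unsatisfied_translate a (J : couplings R) (P : spin_pairs) e :
  unsatisfied (translate_couplings a J) (translate_pair a P) e <->
  unsatisfied J P (e.1 + a, e.2).
Proof.
have bondE s : bond (translate_couplings a J) (translate_spins a s) e =
    bond J s (e.1 + a, e.2).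
  by rewrite !bond_sign /translate_spins /edge_snd /= addrAC.
split => [[_ [s Ps <-]]|[s Ps neg]]; first by rewrite bondE; exists s.
by exists (translate_spins a s); [exists s | rewrite bondE].
Qed.

Lemma walk_event_translate L a :
  (fun w : couplings R * spin_pairs =>
     (translate_couplings a w.1, translate_pair a w.2)) @^-1` @walk_event R 0 L =
  @walk_event R a L.
Proof.
have vis (t : seq dir) : uniq (visited a t) = uniq (visited 0 t).
  have -> : visited a t = map (fun h => h + a) (visited 0 t).
    by rewrite -visited_add add0r.
  by rewrite map_inj_uniq // => x y /addIr.
have cr (t : seq dir) : crossings a t = map (fun e => (e.1 + a, e.2)) (crossings 0 t).
  by rewrite -crossings_add add0r.
apply/seteqP; split => w [t [u h]]; exists t; split.
- by rewrite vis.
- by move=> e; rewrite cr => /mapP[e' /h e'h ->]; rewrite -unsatisfied_translate.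
- by rewrite -vis.
- by move=> e eC; apply/unsatisfied_translate/h; rewrite cr; apply/mapP; exists e.
Qed.

Lemma path_walk (J : couplings R) P f p :
  path (fun x y => `[< dual_unsatisfied_adj J P x y >]) f p ->
  exists2 ds, visited f ds = f :: p &
    forall e, e \in crossings f ds -> unsatisfied J P e.
Proof.
elim: p f => [|g p IH] f /=; first by exists [::].
move=> /andP[/asboolP[e eU /dual_edge_crossed[d dg de]] /IH[ds dsp dsU]].
exists (d :: ds); first by rewrite /visited /= dg -dsp.
move=> e'; rewrite /= inE dg => /orP[/eqP->|/dsU//].
by rewrite de.
Qed.

Lemma finite_close L f : finite_set [set h | close_to L f h].
Proof.
apply: (@sub_finite_set _ _ ((fun k : 'I_L.*2.+1 * 'I_L.*2.+1 =>
  (f.1 + k.1%:Z - L%:Z, f.2 + k.2%:Z - L%:Z)) @` setT)); last exact: finite_image.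
case: f => f1 f2 [h1 h2]; rewrite /close_to /= => close.
have b1 : (`|(h1 - f1 + L%:Z)%R|%N < L.*2.+1)%N by lia.
have b2 : (`|(h2 - f2 + L%:Z)%R|%N < L.*2.+1)%N by lia.
by exists (Ordinal b1, Ordinal b2) => //=; congr (_, _); lia.
Qed.

(** An infinite component leaves the box of radius [L] around [f]. A path that does so, shortened to
    a self-avoiding one, has at least [L] steps, and its first [L] steps form the walk. *)
Lemma percolates_walk_event (w : couplings R * spin_pairs) :
  percolates w.1 w.2 -> exists f, forall L, walk_event f L w.
Proof.
move=> [f inf]; exists f => L.
have [g [[p pathp <-] far]] : exists g, dual_component w.1 w.2 f g /\ ~~ close_to L f g.
  apply: contrapT => h; apply: inf; apply: sub_finite_set (finite_close L f).
  by move=> g gf /=; apply/negPn/negP => far; apply: h; exists g.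
move: far; case/shortenP: pathp => p' /path_walk[ds dsp dsU] up _ far.
have sds : (L <= size ds)%N.
  rewrite leqNgt; apply/negP => lt; move/negP: far; apply.
  have /visited_close : last f p' \in visited f ds by rewrite dsp mem_last.
  by move=> /andP[h1 h2]; rewrite /close_to !(leq_trans _ (ltnW lt)).
have st : size (take L ds) == L by rewrite size_takel.
exists (Tuple st); split.
  by change (uniq (visited f (take L ds))); rewrite visited_take dsp take_uniq.
move=> e; change (e \in crossings f (take L ds) -> unsatisfied w.1 w.2 e).
by rewrite crossings_take => /mem_take/dsU.
Qed.

End percolation.

(** * The counting argument *)

Section double_counting.
Context d (T : measurableType d) (R : realType) (mu : probability T R).

Lemma sum_measure_integral (I : finType) (Q : pred I) (A : I -> set T) :
  (forall i, measurable (A i)) ->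
  (\int[mu]_x (\sum_(i | Q i) \1_(A i) x)%:E = (\sum_(i | Q i) mu (A i)))%E.
Proof.
move=> mA.
under eq_integral do rewrite -sumEFin -big_enum.
rewrite ge0_integral_sum //.
- rewrite big_enum; apply: eq_bigr => i _.
  by rewrite integral_indic // setIT.
- by move=> i; apply/measurable_EFinP; exact: measurable_indic.
Qed.

(** Taking expectations of a pointwise bound between counts. It serves once with [a = 0], to bound a
    count by a constant, and once with both terms. *)
Lemma sum_measure_le (I K : finType) (Q : pred I) (S : pred K)
    (A : I -> set T) (B : K -> set T) (c : R) (a : R) :
  (forall i, measurable (A i)) -> (forall k, measurable (B k)) ->
  0 <= c -> 0 <= a ->
  {ae mu, forall x,
     \sum_(i | Q i) \1_(A i) x <= c + a * \sum_(k | S k) \1_(B k) x :> R} ->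
  \sum_(i | Q i) fine (mu (A i)) <= c + a * \sum_(k | S k) fine (mu (B k)).
Proof.
move=> mA mB c0 a0 le_ae.
have fineE (H : finType) (V : pred H) (C : H -> set T) : (forall h, measurable (C h)) ->
    ((\sum_(h | V h) fine (mu (C h)))%:E = \sum_(h | V h) mu (C h))%E.
  by move=> mC; rewrite -sumEFin; apply: eq_bigr => h _; rewrite fineK // fin_num_measure.
have mS (H : finType) (V : pred H) (C : H -> set T) : (forall h, measurable (C h)) ->
    measurable_fun setT (fun x => \sum_(h | V h) \1_(C h) x : R).
  move=> mC; rewrite (_ : (fun x => _) = (fun x => \sum_(h <- enum V) \1_(C h) x : R)).
    by apply: measurable_sum => h; exact: measurable_indic.
  by apply/funext => x; rewrite big_enum.
have S0 (H : finType) (V : pred H) (C : H -> set T) x : 0 <= \sum_(h | V h) \1_(C h) x :> R.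
  by apply: sumr_ge0 => h _; rewrite indicE.
rewrite -lee_fin EFinD EFinM !fineE // -!sum_measure_integral //.
rewrite -ge0_integralZl //; last 2 first.
- by apply/measurable_EFinP; exact: mS.
- by move=> x _; rewrite lee_fin.
rewrite -[c%:E]mule1 -(probability_setT mu) -(integral_cst mu measurableT).
rewrite -ge0_integralD //; last 2 first.
- by move=> x _; rewrite lee_fin mulr_ge0.
- by apply/measurable_EFinP; apply: measurable_funM; [exact: measurable_cst | exact: mS].
apply: ae_ge0_le_integral => //.
- by move=> x _; rewrite lee_fin.
- by apply/measurable_EFinP; exact: mS.
- by move=> x _; rewrite -EFinM -EFinD lee_fin addr_ge0 ?mulr_ge0.
- apply/measurable_EFinP; apply: measurable_funD; first exact: measurable_cst.
  by apply: measurable_funM; [exact: measurable_cst | exact: mS].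
- by apply: filterS le_ae => x h _; rewrite -EFinM -EFinD lee_fin.
Qed.

End double_counting.

Section counting.
Variables (R : realType) (nu : probability (measurableTypeR R) R).
Variable mu : probability (couplings R * spin_pairs)%type R.
Hypothesis nu_symmetric : symmetric_law nu.
Hypothesis nu_continuous : continuous_law nu.
Hypothesis mu_iid : iid_with_law mu nu
  (fun (e : edge) (w : couplings R * spin_pairs) => w.1 e).
Hypothesis mu_gsp : {ae mu, forall w, ground_state_pair w.1 w.2}.
Hypothesis mu_invariant : translation_invariant mu.
Variables N L : nat.

Let n := (N * L.*2.+1)%N.
Local Notation conf := (configuration N L).

Definition walkers (k : walk_family N L) : {set box N} := [set b | k b != None].

(** The event concerns the couplings only: the spins come from [c], not from the random pair. The
    sign symmetry of the coupling law therefore applies to it. *)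
Definition realized (c : configuration N L) : set (couplings R * spin_pairs) :=
  fst @^-1` [set J | realizes J c].

Let mfst : measurable_fun setT (fst : couplings R * spin_pairs -> couplings R).
Proof. exact: measurable_fst. Qed.

Lemma measurable_realized c : measurable (realized c).
Proof.
rewrite -[X in measurable X]setTI; apply: mfst => //; exact: measurable_realizes.
Qed.

Lemma card_steps (k : walk_family N L) :
  #|steps k| = (#|walkers k| * L)%N.
Proof.
rewrite (_ : steps k = finset.setX (walkers k) finset.setT).
  by rewrite cardsX cardsT card_ord.
by apply/setP => -[b l]; rewrite !inE andbT.
Qed.

Lemma sum_indic_card (T : Type) (I : finType) (Q : pred I) (A : I -> set T) x :
  \sum_(i | Q i) \1_(A i) x = #|[set i | Q i & x \in A i]|%:R :> R.
Proof.
rewrite -sum1_card natr_sum big_mkcond [RHS]big_mkcond; apply: eq_bigr => i _.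
by rewrite inE indicE; case: (Q i) => //=; case: (x \in A i).
Qed.

(** Count the pairs [(c, S)] such that flipping along [S] makes the couplings realize [c]. For
    generic couplings [code_inj] allows at most one pair per code. In expectation, by sign symmetry,
    each [c] counts once per subset of its steps, hence at least [2 ^ (t * L)] times. *)
Lemma sum_realized_le t :
  \sum_(c : conf | (t <= #|walkers c.2|)%N) 2 ^+ (t * L) * fine (mu (realized c)) <=
  #|code_type N L|%:R.
Proof.
pose I := (conf * {set step N L})%type.
pose Q : pred I := fun i => (t <= #|walkers i.1.2|)%N && (i.2 \subset steps i.1.2).
pose A (i : I) : set (couplings R * spin_pairs) :=
  [set w | realizes (flip_couplings (flipped i.1.2 i.2) w.1) i.1].
have AE i : A i = fst @^-1` (flip_couplings (flipped i.1.2 i.2) @^-1`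
    [set J | realizes J i.1]) by [].
have mR c : measurable [set J : couplings R | realizes J c] by exact: measurable_realizes.
have mA i : measurable (A i).
  rewrite AE -[X in measurable X]setTI; apply: mfst => //.
  by rewrite -[X in measurable X]setTI; apply: measurable_flip_couplings.
have muA i : mu (A i) = mu (realized i.1).
  by rewrite AE (law_flip_invariant mfst mu_iid).
apply: (@le_trans _ _ (\sum_(i | Q i) fine (mu (A i)))).
  rewrite /Q -(pair_big_dep (fun c : conf => (t <= #|walkers c.2|)%N)
    (fun c (S : {set step N L}) => S \subset steps c.2)
    (fun c S => fine (mu (A (c, S))))) /=.
  apply: ler_sum => c tc.
  rewrite (eq_bigr (fun=> fine (mu (realized c)))); last by move=> S _; rewrite muA.
  rewrite sumr_const -[leRHS]mulr_natl ler_wpM2r //.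
    by rewrite fine_ge0.
  have -> : #|[pred S : {set step N L} | S \subset steps c.2]| = (2 ^ #|steps c.2|)%N.
    by rewrite -card_powerset; apply: eq_card => S; rewrite !inE.
  rewrite -natrX ler_nat leq_exp2l // card_steps leq_mul2r.
  by rewrite tc orbT.
have := @sum_measure_le _ _ R mu I void Q pred0 A (fun=> set0) #|code_type N L|%:R 0 mA.
rewrite mul0r addr0; apply => //.
have gen := ae_generic mfst mu_iid nu_continuous.
apply: filterS gen => w gen; rewrite mul0r addr0 sum_indic_card ler_nat.
rewrite -(@card_in_imset _ _ (fun i : I => code i.1)); first exact: max_card.
move=> [c1 S1] [c2 S2]; rewrite !inE /=.
move=> /andP[/andP[_ s1] r1] /andP[/andP[_ s2] r2] /=.
by apply: (@code_inj R N L w.1) => //; [move: r1 | move: r2]; rewrite inE.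
Qed.

Lemma bond_extend_restrict J s e : padded n (edge_fst e) -> padded n (edge_snd e) ->
  bond J (extend_spins (restrict_spins N L s)) e = bond J s e :> R.
Proof. by move=> p1 p2; rewrite !bond_sign !extend_restrict. Qed.

Lemma square_padded e : square n (edge_fst e) \/ square n (edge_snd e) ->
  padded n (edge_fst e) /\ padded n (edge_snd e).
Proof.
case: e => [[a b] v]; rewrite /square /padded /edge_fst /edge_snd /=.
by case: v => /=; move: n => m; lia.
Qed.

(** Pointwise, either at most [t] centres start a walk, or the count is at most [N ^ 2] and some
    configuration with at least [t] walkers is realized. *)
Lemma sum_walk_event_le t : (0 < N)%N ->
  \sum_(b : box N) fine (mu (walk_event (centre L b) L)) <=
  t%:R + (N ^ 2)%:R * \sum_(c : conf | (t <= #|walkers c.2|)%N) fine (mu (realized c)).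
Proof.
move=> N0; apply: (@sum_measure_le _ _ R mu (box N) conf xpredT
    (fun c => t <= #|walkers c.2|)%N
    (fun b => walk_event (centre L b) L) realized) => //.
- by move=> b; exact: measurable_walk_event.
- by move=> c; exact: measurable_realized.
apply: filterS mu_gsp => w gsp.
rewrite !sum_indic_card -natrM -natrD ler_nat.
set G := [set _ | _ & _]; have [Gt|Gt] := leqP #|G| t.
  by apply: leq_trans Gt _; exact: leq_addr.
apply: leq_trans (leq_addl _ _); apply: (@leq_trans (N ^ 2)).
  by apply: leq_trans (max_card _) _; rewrite card_prod !card_ord expnS expn1.
rewrite leq_pmulr // card_gt0; apply/set0Pn.
have [s Ps] : exists s, pair_set w.2 s by have [s ->] := pair_setP w.2; exists s; left.
(* Choose one walk at each centre that starts one; the spins come from a representative of the pair,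
   restricted to the block. *)
pose k : walk_family N L := [ffun b => [pick t' : L.-tuple dir | `[<
  uniq (visited (centre L b) t') /\
  forall e, e \in crossings (centre L b) t' -> unsatisfied w.1 w.2 e >]]].
exists (restrict_spins N L s, k); rewrite inE; apply/andP; split.
  apply: leq_trans (ltnW Gt) (subset_leq_card _); apply/fintype.subsetP => b.
  rewrite inE => wb; have [t' ht] : walk_event (centre L b) L w by exact: set_mem wb.
  rewrite inE ffunE; case: pickP => // /(_ t') /negP; case.
  exact/asboolP.
apply/mem_set; split => [C Csq|b t'] /=.
  rewrite (sum_boundaryE _ (finite_fset C)).
  rewrite (eq_big_seq (fun e => bond w.1 s e)) => [|e].
    rewrite -(sum_boundaryE _ (finite_fset C)) -oppr_le0.
    by apply: gsp Ps _ _; exact: finite_fset.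
  rewrite in_fset_set ?inE; last exact: (finite_edge_boundary (finite_fset C)).
  move=> bd; have [p1 p2] : padded n (edge_fst e) /\ padded n (edge_snd e).
    by apply: square_padded; case: bd => -[h1 h2]; [left|right]; exact: Csq.
  by rewrite bond_extend_restrict.
rewrite /k ffunE; case: pickP => // t'' /asboolP[u h] [<-]; split => // e eC.
have [p1 p2] : padded n (edge_fst e) /\ padded n (edge_snd e).
  apply: square_padded; left; apply: (@close_centre_square N L b).
  by have /andP[/visited_close + _] := crossings_visited eC; rewrite size_tuple.
by rewrite bond_extend_restrict //; apply/(unsatisfiedE _ _ Ps)/h.
Qed.

End counting.

(** * Choice of the parameters and conclusion *)

Lemma card_code_type N L : #|code_type N L| =
  (2 ^ (4 * (N * L.*2.+1).+2) * (L.+1 ^ 4).+1 ^ (N ^ 2))%N.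
Proof.
rewrite card_prod !card_ffun card_option card_ffun !card_prod !card_bool !card_ord.
by rewrite mulnn.
Qed.

(** With [L = k * l], this compares the codes available for one walk with [2 ^ (L / k)], leaving a
    spare factor 2 per box to absorb the collar spins. *)
Lemma exponential_dominates k :
  exists l, (2 * ((k * l).+1 ^ 4).+1 <= 2 ^ l)%N.
Proof.
(* These values give [k * l + 2 <= 2 ^ (2 * b)]; the fourth power costs [8 * b] binary digits and
   the factor 2 one more, so [l = 8 * b + 1]. *)
pose b := (8 * k + 2)%N; exists (8 * b + 1)%N.
have hb : (8 * k + 2 <= 2 ^ b)%N by exact/ltnW/ltn_expl.
have hb' : (b.+1 <= 2 ^ b)%N by exact: ltn_expl.
have base : ((k * (8 * b + 1)).+2 <= 2 ^ (2 * b))%N.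
  rewrite mul2n -addnn expnD; apply: leq_trans (leq_mul hb hb'); nia.
apply: (@leq_trans (2 * (2 ^ (2 * b)) ^ 4)); last first.
  by rewrite -expnM -expnS leq_exp2l //; lia.
rewrite leq_mul2l /=; apply: (@leq_trans ((k * (8 * b + 1)).+2 ^ 4)).
  by rewrite ltn_exp2r.
by rewrite leq_exp2r.
Qed.

Section no_percolation.
Variables (R : realType) (nu : probability (measurableTypeR R) R).
Variable mu : probability (couplings R * spin_pairs)%type R.
Hypothesis nu_symmetric : symmetric_law nu.
Hypothesis nu_continuous : continuous_law nu.
Hypothesis mu_iid : iid_with_law mu nu
  (fun (e : edge) (w : couplings R * spin_pairs) => w.1 e).
Hypothesis mu_gsp : {ae mu, forall w, ground_state_pair w.1 w.2}.
Hypothesis mu_invariant : translation_invariant mu.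

Lemma mu_walk_event f L : mu (walk_event f L) = mu (walk_event 0 L).
Proof.
by rewrite -(walk_event_translate R L f) mu_invariant //; exact: measurable_walk_event.
Qed.

(** By translation invariance all [N ^ 2] centres contribute equally. *)
Lemma walk_event_bound N L t : (0 < N)%N ->
  (N ^ 2)%:R * fine (mu (walk_event 0 L)) <=
  t%:R + (N ^ 2)%:R * #|code_type N L|%:R / 2 ^+ (t * L).
Proof.
move=> N0; have := sum_walk_event_le mu_gsp L t N0.
rewrite (eq_bigr (fun=> fine (mu (walk_event 0 L)))); last first.
  by move=> b _; rewrite mu_walk_event.
rewrite sumr_const card_prod !card_ord -mulnn -[X in X <= _]mulr_natl.
move=> /le_trans; apply; rewrite lerD2l -mulrA ler_wpM2l //.
rewrite ler_pdivlMr ?exprn_gt0 // mulrC mulr_sumr.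
exact: (sum_realized_le nu_symmetric nu_continuous mu_iid).
Qed.

Lemma walk_event_small k : (0 < k)%N ->
  exists L, fine (mu (walk_event 0 L)) <= 2 / k%:R.
Proof.
move=> k0; have [l hl] := exponential_dominates k.
pose L := (k * l)%N; exists L.
(* Here [t] is [N ^ 2 / k] and [t * L = l * N ^ 2]. The value of [m] makes [N ^ 2] exceed [k] plus
   the number of stored collar spins, which is linear in [N]. Each of the two terms of
   [walk_event_bound] then contributes at most [1 / k]. *)
pose m := (8 * L + 12 + k)%N; pose N := (k * m)%N; pose t := (k * m ^ 2)%N.
have N0 : (0 < N)%N by rewrite muln_gt0 k0 /m addn_gt0 k0 orbT.
have hN : (k + 4 * (N * L.*2.+1).+2 <= N ^ 2)%N.
  have mN : (m <= N)%N by rewrite leq_pmull.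
  have : (m * N <= N ^ 2)%N by rewrite expnS expn1 leq_mul2r mN orbT.
  by apply: leq_trans; rewrite /m -muln2; nia.
have tkN : (t * k = N ^ 2)%N by rewrite /t /N; ring.
have card_le : (k * #|code_type N L| <= 2 ^ (t * L))%N.
  have -> : (t * L = l * N ^ 2)%N by rewrite -tkN /L; lia.
  rewrite card_code_type (expnM 2 l).
  apply: (@leq_trans ((2 * (L.+1 ^ 4).+1) ^ N ^ 2)); last first.
    by rewrite leq_exp2r // expn_gt0 N0.
  rewrite expnMn mulnA leq_mul2r; apply/orP; right.
  apply: (@leq_trans (2 ^ (k + 4 * (N * L.*2.+1).+2))); last by rewrite leq_exp2l.
  by rewrite expnD leq_mul2r; apply/orP; right; exact/ltnW/ltn_expl.
have kR : 0 < k%:R :> R by rewrite ltr0n.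
have N2R : 0 < (N ^ 2)%:R :> R by rewrite ltr0n expn_gt0 N0.
rewrite -(ler_pM2l N2R); apply: (le_trans (walk_event_bound L t N0)).
have -> : (N ^ 2)%:R * (2 / k%:R) = t%:R + (N ^ 2)%:R / k%:R :> R.
  by rewrite -tkN natrM; field; rewrite gt_eqF.
rewrite lerD2l -mulrA ler_wpM2l // ler_pdivrMr ?exprn_gt0 //.
by rewrite mulrC ler_pdivlMr // mulrC -natrX -natrM ler_nat.
Qed.

(** The intersection lies in every [walk_event f L], so it is enough that these events have
    arbitrarily small probability. *)
Lemma infinite_walks_negligible f : mu.-negligible (\bigcap_L walk_event f L).
Proof.
have mI : measurable (\bigcap_L walk_event (R:=R) f L).
  by apply: bigcapT_measurable => L; exact: measurable_walk_event.
apply/negligibleP => //; apply/eqP; rewrite eq_le measure_ge0 andbT.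
rewrite -[leLHS]fineK ?fin_num_measure // lee_fin.
rewrite leNgt; apply/negP => x0; set x := fine _ in x0.
pose k := Num.bound (2 / x).
have xk : 2 / x < k%:R by apply: archi_boundP; rewrite divr_ge0 // ltW.
have k0 : 0 < k%:R :> R by apply: le_lt_trans xk; rewrite divr_ge0 // ltW.
have [L le2] := walk_event_small (eqbLR (ltr0n R k) k0).
have : x <= 2 / k%:R.
  apply: le_trans le2; rewrite -(mu_walk_event f L).
  rewrite fine_le ?fin_num_measure //; try exact: measurable_walk_event.
  apply: le_measure; rewrite ?inE //; first exact: measurable_walk_event.
  by move=> w; apply.
by rewrite leNgt ltr_pdivrMr // mulrC -ltr_pdivrMr // xk.
Qed.

Lemma no_percolation : {ae mu, forall w, ~ percolates w.1 w.2}.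
Proof.
pose G k := if (choice.unpickle k : option dual_vertex) is Some f
  then \bigcap_L walk_event (R:=R) f L else set0.
change (mu.-negligible (~` [set w | ~ percolates w.1 w.2])).
apply: (@negligibleS _ _ _ mu (\bigcup_k G k)).
  move=> w /= /contrapT/percolates_walk_event[f hf].
  by exists (choice.pickle f) => //; rewrite /G choice.pickleK => L _; exact: hf.
apply: negligible_bigcup => k; rewrite /G.
case: choice.unpickle => [f|]; last exact: negligible_set0.
exact: infinite_walks_negligible.
Qed.

End no_percolation.

Theorem theorem23 (R : realType)
    (nu : probability (measurableTypeR R) R)
    (nu_symmetric : symmetric_law nu)
    (nu_continuous : continuous_law nu)
    (nu_support : law_support nu = [set: R])
    (mu : probability (couplings R * spin_pairs)%type R)
    (mu_iid : iid_with_law mu nu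
       (fun (e : edge) (w : couplings R * spin_pairs) => w.1 e))
    (mu_gsp : {ae mu, forall w, ground_state_pair w.1 w.2})
    (mu_invariant : translation_invariant mu) :
  {ae mu, forall w, ~ percolates w.1 w.2}.
Proof.
exact: no_percolation nu_symmetric nu_continuous mu_iid mu_gsp mu_invariant.
Qed.
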